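(* Let $A$ be a finite-dimensional evolution algebra over a field $\mathbb K$. The following conditions are equivalent: (i) $A$ is simple. (ii) $A=A^2$ and the graph $E_A$ associated to $A$ is strongly connected. (iii) $A=A^2$ and $A$ is basic simple.
   Context: An evolution algebra over a field $\mathbb K$ is a $\mathbb K$-algebra $A$ (not necessarily associative) provided with a basis $B=\{e_i \mid i\in\Lambda\}$, where $\Lambda$ is a non-empty set, such that $e_ie_j=0$ whenever $i\neq j$; such a basis is called a natural basis. Write $e_i^2=\sum_{k\in\Lambda}\omega_{ki}e_k$; the matrix $M_B=(\omega_{ki})$ is the structure matrix of $A$ relative to $B$. $A^2$ denotes the linear span of all products of two elements of $A$, and $A$ is called perfect if $A^2=A$. An algebra $A$ is said to be simple if it has no nonzero proper ideals. The graph associated to $A$ relative to $B$ is the directed graph with vertex set $\Lambda$ having exactly one edge from $i$ to $j$ if $\omega_{ji}\neq 0$, and no edge from $i$ to $j$ otherwise. When $A$ is finite-dimensional and $A=A^2$, this graph is uniquely determined (it does not depend on the natural basis chosen), and it is denoted $E_A$. A directed graph is strongly connected if, given two different vertices $u,v$, there exists a directed path from $u$ to $v$. A perfect finite-dimensional evolution algebra $A$ is basic simple if the ideal generated by every element in any natural basis of $A$ is $A$.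
   Formalization: ''Simple'' is taken to include A² ≠ 0 in addition to having no nonzero proper ideals; otherwise the one-dimensional evolution algebra Ke with e² = 0 would satisfy (i) but neither (ii) nor (iii). No other algebra is affected. *)

(* Defs.v *)
From HB Require Import structures.
From mathcomp Require Import all_boot all_order all_algebra.

Set Implicit Arguments.
Unset Strict Implicit.
Unset Printing Implicit Defensive.

Import GRing.Theory.
Local Open Scope ring_scope.

(* A finite-dimensional, not necessarily associative, commutative or unital
   algebra over K is a vectType A over K together with a bilinear product
   mul : {bilinear A -> A -> A}. *)

Section Algebra.

Variables (K : fieldType) (A : vectType K) (mul : {bilinear A -> A -> A}).

(* The analogue of falgebra's prodv for a product that need not be
   associative; see mem_asquare. *)
Definition asquare : {vspace A} :=
  (<<[seq mul x y | x <- vbasis {:A}, y <- vbasis {:A}]>>)%VS.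

Lemma mul_asquare x y : mul x y \in asquare.
Proof.
rewrite (coord_vbasis (memvf x)) linear_sumlz /=; apply: memv_suml => i _.
rewrite (coord_vbasis (memvf y)) linear_sumr /=; apply: memv_suml => j _.
rewrite linearZl_LR /= linearZr /= !memvZ // memv_span //.
by apply/allpairsP; exists ((vbasis {:A})`_i, (vbasis {:A})`_j); rewrite !mem_nth ?size_tuple.
Qed.

(* asquare is the linear span of all products of two elements. *)
Lemma mem_asquare z :
  z \in asquare <->
  exists s : seq (K * (A * A)), z = \sum_(t <- s) t.1 *: mul t.2.1 t.2.2.
Proof.
split=> [|[s ->]]; last first.
  by apply: memv_suml => t _; rewrite memvZ ?mul_asquare.
rewrite /asquare; set X := [seq _ | _ <- _, _ <- _] => /(@coord_span _ _ _ (in_tuple X)) ->.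
have XP (i : 'I_(size X)) : exists p : A * A, X`_i == mul p.1 p.2.
  have /allpairsP[p [_ _ ->]] : X`_i \in X by rewrite mem_nth.
  by exists p.
exists [seq (coord (in_tuple X) i z, xchoose (XP i)) | i <- index_enum 'I_(size X)].
by rewrite big_map; apply: eq_bigr => i _; rewrite /= -(eqP (xchooseP (XP i))).
Qed.

Definition perfect : Prop := asquare = fullv.

Definition is_ideal (I : {vspace A}) : Prop :=
  forall a x, x \in I -> mul a x \in I /\ mul x a \in I.

(* As usual for nonassociative algebras, the zero product is excluded.
   Otherwise the one-dimensional algebra with zero product, which is an
   evolution algebra, would be simple without being perfect. *)
Definition simple_algebra : Prop :=
  asquare <> 0%VS /\
  forall I : {vspace A}, is_ideal I -> I = 0%VS \/ I = fullv.

(* I is the ideal generated by x, i.e. the smallest ideal containing x. *)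
Definition is_ideal_generated_by (x : A) (I : {vspace A}) : Prop :=
  [/\ is_ideal I, x \in I &
      forall J : {vspace A}, is_ideal J -> x \in J -> (I <= J)%VS].

Definition natural_basis (n : nat) (B : n.-tuple A) : Prop :=
  basis_of fullv B /\
  forall i j : 'I_n, i != j -> mul (tnth B i) (tnth B j) = 0.

(* Column i holds the coordinates of the square of the i-th basis vector. *)
Definition structure_matrix (n : nat) (B : n.-tuple A) : 'M[K]_n :=
  \matrix_(k, i) coord B k (mul (tnth B i) (tnth B i)).

Definition evolution_graph (n : nat) (B : n.-tuple A) : rel 'I_n :=
  fun i j => structure_matrix B j i != 0.

Definition basic_simple : Prop :=
  forall (n : nat) (B : n.-tuple A), natural_basis B ->
  forall i : 'I_n, is_ideal_generated_by (tnth B i) fullv.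

End Algebra.

Definition strongly_connected (V : finType) (e : rel V) : Prop :=
  forall u v : V, u != v -> connect e u v.

(* Main.v *)
Require Import Defs.
From HB Require Import structures.
From mathcomp Require Import all_boot all_order all_algebra.

(** A natural basis [e] makes the product diagonal:
    [x * y = \sum_i x_i y_i e_i^2], where [x_i] is the [i]-th coordinate.  Hence
    [e_i * x = x_i e_i^2], and everything about ideals is read off from the
    squares [e_i^2] and the edges of the graph.

    An ideal that contains some [x != 0] contains a square [e_i^2], because some
    [x_i] is nonzero.  It then contains the squares of all successors of [i],
    since [e_j * e_i^2 = w_ji e_j^2], and so of all descendants of [i]
    ([square_descendant_ideal]).  If the graph is strongly connected, these are
    all the squares, so the ideal contains [A^2], which is [A] when [A] is
    perfect: [A] is simple ([strongly_connected_simple]).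

    Conversely, the elements supported on the descendants of a vertex [u] form
    an ideal that contains [e_u] ([descendant_ideal]).  If [A] is simple, or if
    merely each [e_u] generates [A], this ideal is [A], so every vertex is
    reachable from [u] ([generators_strongly_connected]).  Since [A^2] is itself
    an ideal, a simple algebra is perfect, and in it every nonzero element,
    in particular every natural basis vector, generates [A].  *)

Set Implicit Arguments.
Unset Strict Implicit.
Unset Printing Implicit Defensive.

Import GRing.Theory.
Local Open Scope ring_scope.

Section SimpleAlgebra.

Variables (K : fieldType) (A : vectType K) (mul : {bilinear A -> A -> A}).

Lemma asquare_ideal : is_ideal mul (asquare mul).
Proof. by move=> a x _; split; apply: mul_asquare. Qed.

Lemma fullv_ideal : is_ideal mul fullv.
Proof. by move=> a x _; split; apply: memvf. Qed.

Lemma simple_perfect : simple_algebra mul -> perfect mul.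
Proof. by case=> sq_neq0 /(_ _ asquare_ideal) []. Qed.

Lemma simple_generator x :
  simple_algebra mul -> x != 0 -> is_ideal_generated_by mul x fullv.
Proof.
move=> [_ simA] x_neq0; split; [exact: fullv_ideal | exact: memvf |].
move=> J /simA [] -> // /[!memv0] x0.
by rewrite x0 in x_neq0.
Qed.

Lemma natural_basis_neq0 m (C : m.-tuple A) i :
  natural_basis mul C -> tnth C i != 0.
Proof. by move=> [basC _]; apply: basis_not0 basC (mem_tnth i C). Qed.

Lemma simple_basic_simple : simple_algebra mul -> basic_simple mul.
Proof.
move=> simA m C natC i; apply: simple_generator => //.
exact: natural_basis_neq0 i natC.
Qed.

End SimpleAlgebra.

Section NaturalBasis.

Variables (K : fieldType) (A : vectType K) (mul : {bilinear A -> A -> A}).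
Variables (n : nat) (B : n.-tuple A).
Hypothesis natB : natural_basis mul B.

Local Notation e i := (tnth B i).
Local Notation graph := (evolution_graph mul B).

Lemma natural_basis_sum x : x = \sum_i coord B i x *: e i.
Proof.
case: natB => basB _; rewrite {1}(coord_basis basB (memvf x)).
by apply: eq_bigr => i _; rewrite (tnth_nth 0).
Qed.

Lemma coord_natural_basis i j : coord B i (e j) = (i == j)%:R.
Proof.
case: natB => basB _.
by rewrite (tnth_nth 0) coord_free ?(basis_free basB) // eq_sym.
Qed.

Lemma natural_mulE x y :
  mul x y = \sum_i (coord B i x * coord B i y) *: mul (e i) (e i).
Proof.
rewrite {1}(natural_basis_sum x) linear_sumlz; apply: eq_bigr => i _.
rewrite {1}(natural_basis_sum y) linear_sumr (bigD1 i) //= big1 ?addr0.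
  by rewrite linearZl_LR linearZr /= scalerA.
move=> j ji; rewrite linearZl_LR linearZr /=.
by case: natB => _ -> //; rewrite ?scaler0 // eq_sym.
Qed.

Lemma natural_mul_basis i x : mul (e i) x = coord B i x *: mul (e i) (e i).
Proof.
rewrite natural_mulE (bigD1 i) //= big1 ?addr0.
  by rewrite coord_natural_basis eqxx mul1r.
by move=> j /negPf ji; rewrite coord_natural_basis ji mul0r scale0r.
Qed.

Lemma asquare_sub_squares (I : {vspace A}) :
  (forall i, mul (e i) (e i) \in I) -> (asquare mul <= I)%VS.
Proof.
move=> sqI; apply/span_subvP => _ /allpairsP[p [_ _ ->]].
by rewrite natural_mulE; apply: memv_suml => i _; rewrite memvZ.
Qed.

(** Multiplying [x] by [e i] keeps only the [i]-th term of its expansion and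
    leaves [x_i e_i^2], a nonzero multiple of the square. *)
Lemma ideal_mem_square (I : {vspace A}) x i :
  is_ideal mul I -> x \in I -> coord B i x != 0 -> mul (e i) (e i) \in I.
Proof.
move=> idI /(idI (e i)) [+ _] xi_neq0.
by rewrite natural_mul_basis rpredZeq (negPf xi_neq0).
Qed.

(** The coordinate of [e_i^2] at a successor [j] of [i] is nonzero, so squares
    propagate along edges. *)
Lemma square_descendant_ideal (I : {vspace A}) i j :
  is_ideal mul I -> mul (e i) (e i) \in I -> connect graph i j ->
  mul (e j) (e j) \in I.
Proof.
move=> idI + /connectP[p]; elim: p i => [i sqi _ -> //|k p IHp i sqi /=].
move=> /andP[ik path_p]; apply: IHp path_p.
by apply: ideal_mem_square sqi _ => //; rewrite /evolution_graph mxE in ik.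
Qed.

Lemma ex_coord_neq0 x : x != 0 -> exists i, coord B i x != 0.
Proof.
move=> x_neq0; apply/existsP; apply: contraR x_neq0 => /existsPn x0.
rewrite (natural_basis_sum x) big1 // => i _.
by have /negPn/eqP -> := x0 i; rewrite scale0r.
Qed.

Lemma strongly_connected_simple :
  (0 < n)%N -> perfect mul -> strongly_connected graph -> simple_algebra mul.
Proof.
move=> n_gt0 perfA scA; split=> [|I idI].
  rewrite perfA => full0.
  by case/negP: (natural_basis_neq0 (Ordinal n_gt0) natB); rewrite -memv0 -full0 memvf.
have [->|I_neq0] := eqVneq I 0%VS; [by left | right].
have [i xi_neq0] : exists i, coord B i (vpick I) != 0.
  by apply: ex_coord_neq0; rewrite vpick0.
have sqi := ideal_mem_square idI (memv_pick I) xi_neq0.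
apply/eqP; rewrite eqEsubv subvf /= -perfA; apply: asquare_sub_squares => j.
have [<- //|ij] := eqVneq i j.
by apply: square_descendant_ideal sqi _ => //; apply: scA.
Qed.

(** This is the span of the [e_k] with [k] a descendant of [u].  Cutting it out
    by linear forms makes both uses coordinatewise: stability under products,
    and the fact that it omits [e_v] when [v] is not reachable from [u]. *)
Definition descendant_space u : {vspace A} :=
  (\bigcap_(k | ~~ connect graph u k) lker (linfun (coord B k : A -> K^o)))%VS.

Lemma mem_descendant_space u x :
  reflect (forall k, ~~ connect graph u k -> coord B k x = 0)
          (x \in descendant_space u).
Proof.
rewrite memvE; apply: (iffP subv_bigcapP) => H k /H.
  by rewrite -memvE memv_ker lfunE => /eqP.
by rewrite -memvE memv_ker lfunE /= => ->.
Qed.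

Lemma descendant_ideal u : is_ideal mul (descendant_space u).
Proof.
(* In the [k]-th coordinate of [x * y], with [k] not a descendant of [u], the
   term [x_i y_i w_ki] vanishes: if [i] is a descendant of [u] then [w_ki = 0],
   for otherwise the edge from [i] to [k] would make [k] one; if not, then
   [x_i y_i = 0]. *)
have desc_mul x y k : ~~ connect graph u k ->
    (forall i, ~~ connect graph u i -> coord B i x * coord B i y = 0) ->
    coord B k (mul x y) = 0.
  move=> uk xy0; rewrite natural_mulE linear_sum big1 // => i _.
  rewrite linearZ /=; have [ui|/xy0 ->] := boolP (connect graph u i); last first.
    by rewrite mul0r.
  have [->|ik] := eqVneq (coord B k (mul (e i) (e i))) 0; first by rewrite mulr0.
  case/negP: uk; apply: connect_trans ui (connect1 _).
  by rewrite /evolution_graph mxE.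
move=> a x /mem_descendant_space x0.
by split; apply/mem_descendant_space => k /desc_mul -> // i /x0 ->;
  rewrite ?mulr0 ?mul0r.
Qed.

Lemma mem_descendant_space_root u : e u \in descendant_space u.
Proof.
apply/mem_descendant_space => k; rewrite coord_natural_basis.
by have [->|//] := eqVneq k u; rewrite connect0.
Qed.

Lemma generators_strongly_connected :
  (forall u, is_ideal_generated_by mul (e u) fullv) -> strongly_connected graph.
Proof.
move=> genA u v _; have [_ _ minA] := genA u.
have full_sub := minA _ (@descendant_ideal u) (mem_descendant_space_root u).
have /mem_descendant_space e0 := subvP full_sub _ (memvf (e v)).
by apply: contraT => /e0/eqP; rewrite coord_natural_basis eqxx oner_eq0.
Qed.

End NaturalBasis.

Theorem lemma2p7 (K : fieldType) (A : vectType K)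
    (mul : {bilinear A -> A -> A}) (n : nat) (B : n.-tuple A)
    (n_gt0 : (0 < n)%N) (natB : natural_basis mul B) :
  (simple_algebra mul <->
     perfect mul /\ strongly_connected (evolution_graph mul B)) /\
  (simple_algebra mul <-> perfect mul /\ basic_simple mul).
Proof.
have scA_of_bsA : basic_simple mul -> strongly_connected (evolution_graph mul B).
  by move=> /(_ n B natB); apply: generators_strongly_connected.
split; split=> [simA|[perfA]].
- split; first exact: simple_perfect.
  exact/scA_of_bsA/simple_basic_simple.
- exact: strongly_connected_simple.
- by split; [apply: simple_perfect | apply: simple_basic_simple].
- by move/scA_of_bsA; apply: strongly_connected_simple.
Qed.
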